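(* Let $M\ge 2$, $N=2M$, and let $\{\beta_k,B_k,L_k\}_{k=1}^N$ be juncture parameters of Type II-AEE, i.e. $$L_{N-k+1}=L_k\quad (k=1,\dots,M),\qquad B_k=\beta_{N-k+1}\quad (k=1,\dots,N),$$ satisfying the continuity constraint $\sum_{k=1}^{N}L_k\cos\beta_k=0=\sum_{k=1}^{N}L_k\cos B_k$ (equivalently $\sum_{k=1}^M L_k(\cos\beta_k+\cos\beta_{N-k+1})=0$). Then the prismatic juncture with these parameters is flexible.
   Context: Juncture parameters: for an even integer $N\ge 4$, real numbers $L_k>0$ (edge lengths) and $\beta_k,B_k\in(0,\pi)$ (face angles), $k=1,\dots,N$; the index $k$ is cyclic mod $N$. For an angle $\theta\in(0,\pi/2)$ let $\mathbf u(\theta)=(-\sin\theta,-\cos\theta,0)$ and $\mathbf w(\theta)=(\sin\theta,-\cos\theta,0)$. A prismatic juncture at $\theta$ with the given parameters is a closed polygon $\mathbf v_1,\dots,\mathbf v_N\in\mathbb R^3$ ($\mathbf v_{N+1}=\mathbf v_1$) with, for every $k=1,\dots,N$, $$|\mathbf v_{k+1}-\mathbf v_k|=L_k,\quad (\mathbf v_{k+1}-\mathbf v_k)\cdot\mathbf u(\theta)=L_k\cos\beta_k,\quad (\mathbf v_{k+1}-\mathbf v_k)\cdot\mathbf w(\theta)=L_k\cos B_k .$$ Geometrically, two unbounded annular tubes meet along this polygon: one made of the half-strips $\{\mathbf p+s\mathbf u:\mathbf p\in[\mathbf v_k,\mathbf v_{k+1}],\ s\ge0\}$, the other of the half-strips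 $\{\mathbf p+s\mathbf w:\mathbf p\in[\mathbf v_k,\mathbf v_{k+1}],\ s\ge0\}$; $\beta_k$ and $B_k$ are the face angles at $\mathbf v_k$. Self-intersections are allowed. The juncture with given parameters is flexible, with $\theta$ as the variable of flexion, if there are an interval $I\subset(0,\pi/2)$ of positive length and continuous maps $\mathbf v_1,\dots,\mathbf v_N:I\to\mathbb R^3$ such that for every $\theta\in I$ the points $\mathbf v_1(\theta),\dots,\mathbf v_N(\theta)$ form a prismatic juncture at $\theta$ with these fixed parameters.
   Formalization: It is additionally assumed that at some θ in (0, π/2) a prismatic juncture with these parameters exists having no edge in the plane spanned by u(θ) and w(θ); without this, parameters satisfying all the conditions may admit no juncture at all. *)

(* Defs.v *)
From HB Require Import structures.
From mathcomp Require Import all_boot all_order all_algebra.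
From mathcomp Require Import all_classical all_reals all_analysis.

Set Implicit Arguments.
Unset Strict Implicit.
Unset Printing Implicit Defensive.

Import Order.TTheory GRing.Theory Num.Theory.
Import numFieldNormedType.Exports.

Local Open Scope classical_set_scope.
Local Open Scope ring_scope.

(* The library's norm `|_| on row vectors is the sup norm, so the Euclidean
   structure of R^3 is written out here. *)
Definition dotv (R : realType) (x y : 'rV[R]_3) : R := \sum_i x 0 i * y 0 i.

Definition enorm (R : realType) (x : 'rV[R]_3) : R := Num.sqrt (dotv x x).

Definition vec3 (R : realType) (x y z : R) : 'rV[R]_3 :=
  \row_(i < 3) [:: x; y; z]`_i.

Definition uvec (R : realType) (theta : R) : 'rV[R]_3 :=
  vec3 (- sin theta) (- cos theta) 0.

Definition wvec (R : realType) (theta : R) : 'rV[R]_3 :=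
  vec3 (sin theta) (- cos theta) 0.

(* Indices run over 0, ..., N - 1 instead of 1, ..., N; ordS is the cyclic
   successor. *)
Definition edge (R : realType) (N : nat) (v : 'I_N -> 'rV[R]_3) (k : 'I_N) :
  'rV[R]_3 := v (ordS k) - v k.

Definition juncture_parameters (R : realType) (N : nat)
    (L beta B : 'I_N -> R) : Prop :=
  [/\ (4 <= N)%N, ~~ odd N &
    forall k, [/\ 0 < L k, 0 < beta k < pi & 0 < B k < pi]].

Definition prismatic_juncture (R : realType) (N : nat) (L beta B : 'I_N -> R)
    (theta : R) (v : 'I_N -> 'rV[R]_3) : Prop :=
  forall k, [/\ enorm (edge v k) = L k,
    dotv (edge v k) (uvec theta) = L k * cos (beta k) &
    dotv (edge v k) (wvec theta) = L k * cos (B k)].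

(* No edge lies in the plane spanned by the two tube directions: the half-strips
   of the two tubes that meet along an edge are never coplanar. *)
Definition nondegenerate_juncture (R : realType) (N : nat) (theta : R)
    (v : 'I_N -> 'rV[R]_3) : Prop :=
  forall k, ~~ (edge v k <= uvec theta + wvec theta)%MS.

Definition flexible (R : realType) (N : nat) (L beta B : 'I_N -> R) : Prop :=
  exists (I : set R) (v : 'I_N -> R -> 'rV[R]_3),
    [/\ is_interval I,
        I `<=` [set theta | 0 < theta < pi / 2],
        exists a b, [/\ I a, I b & a < b],
        forall k, {within I, continuous (v k)} &
        forall theta, I theta ->
          prismatic_juncture L beta B theta (fun k => v k theta)].

(* With 0-based indices, rev_ord is the reflection k |-> N - k + 1. *)
Definition type_II_AEE (R : realType) (M N : nat) (L beta B : 'I_N -> R) : Prop :=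
  (forall k : 'I_N, (k < M)%N -> L (rev_ord k) = L k) /\
  (forall k : 'I_N, B k = beta (rev_ord k)).

Definition continuity_constraint (R : realType) (N : nat)
    (L beta B : 'I_N -> R) : Prop :=
  \sum_k L k * cos (beta k) = 0 /\ \sum_k L k * cos (B k) = 0.

(* Main.v *)
Require Import Defs.
From mathcomp Require Import all_boot all_order all_algebra.
From mathcomp Require Import all_classical all_reals all_analysis.
From mathcomp Require Import ring lra zify.
Import Order.TTheory GRing.Theory Num.Theory.
Import numFieldNormedType.Exports.
Local Open Scope ring_scope.

(** The two scalar products with [uvec theta] and [wvec theta] determine the
   first two coordinates of an edge, and the length then determines its third
   coordinate up to sign. Exchanging the two face angles negates the first
   coordinate and keeps the second one, so under the Type II-AEE symmetry the
   edges [k] and [N - k + 1] have the same squared third coordinate; giving them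
   opposite signs closes the polygon in the third direction, while the first two
   coordinates sum to zero by the continuity constraint. The only obstruction
   is that the squared third coordinate be nonnegative: it is positive at the
   given nondegenerate juncture, hence on a neighborhood of its angle. *)

Section PolygonOfEdges.
Context {N : nat} {V : zmodType} (e : 'I_N -> V).

Definition polygon_of_edges (k : 'I_N) : V := \sum_(j < N | (j < k)%N) e j.

Lemma polygon_of_edgesS (k : 'I_N) : \sum_j e j = 0 ->
  polygon_of_edges (ordS k) - polygon_of_edges k = e k.
Proof.
move=> e0; rewrite /polygon_of_edges.
have -> : \sum_(j < N | (j < ordS k)%N) e j = \sum_(j < N | (j < k.+1)%N) e j.
  rewrite /=; have := ltn_ord k; rewrite leq_eqVlt => /orP[/eqP kN|kN].
    (* At the last index [ordS k] wraps around to 0: the left sum is empty and the right one is the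
       full sum, so [e0] closes the polygon. *)
    rewrite {1}kN modnn big_pred0 //; apply: esym; rewrite -[RHS]e0.
    by apply: eq_bigl => j; rewrite kN ltn_ord.
  by rewrite modn_small.
rewrite (bigD1 k) //=; apply/eqP; rewrite subr_eq; apply/eqP; congr (_ + _).
by apply: eq_bigl => j; rewrite ltnS ltn_neqAle andbC.
Qed.

End PolygonOfEdges.

Section Vec3.
Context {R : realType}.

Lemma vec30 : vec3 0 0 0 = 0 :> 'rV[R]_3.
Proof. by apply/rowP; case=> [[|[|[|]]]] //= ?; rewrite !mxE. Qed.

Lemma sum_vec3 (I : finType) (x y z : I -> R) :
  \sum_i vec3 (x i) (y i) (z i) = vec3 (\sum_i x i) (\sum_i y i) (\sum_i z i).
Proof.
apply/rowP; case=> [[|[|[|]]]] //= ?; rewrite summxE !mxE;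
  by apply: eq_bigr => i _; rewrite !mxE.
Qed.

Lemma vec3_eta (v : 'rV[R]_3) : v = vec3 (v 0 0) (v 0 1) (v 0 2).
Proof.
apply/rowP; case=> [[|[|[|]]]] //= lti; rewrite !mxE /=;
  congr (v _ _); exact/val_inj.
Qed.

Lemma dotv_vec3 (x y z x' y' z' : R) :
  dotv (vec3 x y z) (vec3 x' y' z') = x * x' + y * y' + z * z'.
Proof. by rewrite /dotv !big_ord_recl big_ord0 !mxE /= addr0 addrA. Qed.

Lemma cvg_vec3 (T : Type) (F : set_system T) {FF : Filter F} (f g h : T -> R)
    (a b c : R) :
  (f @ F --> a)%classic -> (g @ F --> b)%classic -> (h @ F --> c)%classic ->
  ((fun t => vec3 (f t) (g t) (h t)) @ F --> vec3 a b c)%classic.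
Proof.
(* Expanding in the canonical basis reduces convergence of vectors to sums of convergent scalars
   times fixed vectors. *)
have vec3E x y z : vec3 x y z =
    x *: vec3 1 0 0 + y *: vec3 0 1 0 + z *: vec3 0 0 1 :> 'rV[R]_3.
  by apply/rowP; case=> [[|[|[|]]]] //= ?; rewrite !mxE /=; ring.
move=> fa gb hc; rewrite vec3E; under eq_fun do rewrite vec3E.
by apply: cvgD; [apply: cvgD|]; apply: cvgZr_tmp.
Qed.

End Vec3.

Section Edge.
Context {R : realType}.
Implicit Types l b B t z : R.

(** Difference and sum of the equations [- x sin t - y cos t = l cos b] and
    [x sin t - y cos t = l cos B], solved for [x] and [y]. What the length leaves for the square of
    the third coordinate is [edge_z2], which may be negative. *)
Definition edge_x l b B t := l * (cos B - cos b) / (2 * sin t).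
Definition edge_y l b B t := - (l * (cos b + cos B)) / (2 * cos t).
Definition edge_z2 l b B t := l ^+ 2 - edge_x l b B t ^+ 2 - edge_y l b B t ^+ 2.

Lemma edge_xC l b B t : edge_x l B b t = - edge_x l b B t.
Proof. by rewrite /edge_x -mulNr -mulrN opprB. Qed.

Lemma edge_yC l b B t : edge_y l B b t = edge_y l b B t.
Proof. by rewrite /edge_y addrC. Qed.

Lemma edge_z2C l b B t : edge_z2 l B b t = edge_z2 l b B t.
Proof. by rewrite /edge_z2 edge_xC edge_yC sqrrN. Qed.

Lemma sin_cos_gt0_pihalf t : 0 < t < pi / 2 -> 0 < sin t /\ 0 < cos t.
Proof.
move=> ht; split; first exact: sin_gt0_pihalf.
by apply: cos_gt0_pihalf; case/andP: ht => t0 t1; apply/andP; split; lra.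
Qed.

Lemma dotv_edge l b B t z : 0 < t < pi / 2 ->
  let e := vec3 (edge_x l b B t) (edge_y l b B t) z in
  dotv e (uvec t) = l * cos b /\ dotv e (wvec t) = l * cos B.
Proof.
move=> /sin_cos_gt0_pihalf[st ct] /=.
rewrite /uvec /wvec !dotv_vec3 /edge_x /edge_y.
by split; field; rewrite !gt_eqF.
Qed.

Lemma enorm_edge l b B t z : 0 <= l -> z ^+ 2 = edge_z2 l b B t ->
  enorm (vec3 (edge_x l b B t) (edge_y l b B t) z) = l.
Proof.
move=> l0 hz; rewrite /enorm dotv_vec3 -!expr2 hz /edge_z2.
by rewrite (_ : _ + _ = l ^+ 2) ?sqrtr_sqr ?ger0_norm //; ring.
Qed.

(** Converse of [dotv_edge] and [enorm_edge]: at the given juncture it exhibits [edge_z2] as a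
    square. *)
Lemma edge_coords l b B t (e : 'rV[R]_3) : 0 < t < pi / 2 ->
  enorm e = l -> dotv e (uvec t) = l * cos b -> dotv e (wvec t) = l * cos B ->
  [/\ e 0 0 = edge_x l b B t, e 0 1 = edge_y l b B t &
      e 0 2 ^+ 2 = edge_z2 l b B t].
Proof.
move=> /sin_cos_gt0_pihalf[st ct]; rewrite /enorm [e]vec3_eta.
rewrite /uvec /wvec !dotv_vec3 -vec3_eta => he hu hw.
have hx : e 0 0 = edge_x l b B t.
  by rewrite /edge_x mulrBr -hu -hw; field; rewrite gt_eqF.
have hy : e 0 1 = edge_y l b B t.
  by rewrite /edge_y mulrDr -hu -hw; field; rewrite gt_eqF.
split=> //; rewrite /edge_z2 -hx -hy -he sqr_sqrtr; first by ring.
by rewrite -!expr2 !addr_ge0 ?sqr_ge0.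
Qed.

(** Since [sin t] and [cos t] are nonzero, the tube directions span the whole horizontal plane;
    hence a nondegenerate edge has a nonzero third coordinate. *)
Lemma vec3_sub_uvec_wvec x y t : 0 < t < pi / 2 ->
  (vec3 x y 0 <= uvec t + wvec t)%MS.
Proof.
move=> /sin_cos_gt0_pihalf[st ct]; apply/sub_addsmxP.
(* Solution of [(q - p) sin t = x] and [- (p + q) cos t = y]. *)
pose p := - x / (2 * sin t) - y / (2 * cos t).
pose q := x / (2 * sin t) - y / (2 * cos t).
exists (p%:M, q%:M) => /=; rewrite !mul_scalar_mx /p /q.
apply/rowP; case=> [[|[|[|]]]] //= ?; rewrite !mxE /=; field; by rewrite !gt_eqF.
Qed.

Lemma cvg_edge_x l b B t : sin t != 0 ->
  (edge_x l b B s @[s --> t] --> edge_x l b B t)%classic.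
Proof.
move=> st; apply: cvgM; first exact: cvg_cst.
apply: cvgV; first by rewrite mulf_neq0.
by apply: cvgM; [exact: cvg_cst|exact: continuous_sin].
Qed.

Lemma cvg_edge_y l b B t : cos t != 0 ->
  (edge_y l b B s @[s --> t] --> edge_y l b B t)%classic.
Proof.
move=> ct; apply: cvgM; first exact: cvg_cst.
apply: cvgV; first by rewrite mulf_neq0.
by apply: cvgM; [exact: cvg_cst|exact: continuous_cos].
Qed.

Lemma cvg_edge_z2 l b B t : sin t != 0 -> cos t != 0 ->
  (edge_z2 l b B s @[s --> t] --> edge_z2 l b B t)%classic.
Proof.
move=> st ct; apply: cvgB.
  apply: cvgB; first exact: cvg_cst.
  by rewrite expr2; under eq_fun do rewrite expr2; apply: cvgM; exact: cvg_edge_x.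
by rewrite expr2; under eq_fun do rewrite expr2; apply: cvgM; exact: cvg_edge_y.
Qed.

End Edge.

(** Reindexing by the reflection equates the sum with its own opposite. *)
Lemma sum_odd_rev_ord {R : numDomainType} (N : nat) (f : 'I_N -> R) :
  (forall k, f (rev_ord k) = - f k) -> \sum_k f k = 0.
Proof.
move=> hf; apply/eqP; rewrite -eqNr -sumrN.
by rewrite [X in _ == X](reindex_inj rev_ord_inj) (eq_bigr _ (fun k _ => hf k)).
Qed.

Section TypeIIAEE.
Context {R : realType} {N : nat} (M : nat) (L beta B : 'I_N -> R).
Context (hN : N = (2 * M)%N) (htype : type_II_AEE M L beta B).

Lemma leq_rev_ord (k : 'I_N) : (M <= rev_ord k)%N = (k < M)%N.
Proof. by rewrite /=; have := ltn_ord k; lia. Qed.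

Lemma type_II_AEE_L (k : 'I_N) : L (rev_ord k) = L k.
Proof.
have [hL _] := htype; have [/hL //|] := ltnP k M.
(* An index of the second half is the reflection of one in the first half, where [hL] applies. *)
rewrite -{1}[k]rev_ordK leq_rev_ord => /hL <-; by rewrite rev_ordK.
Qed.

Lemma type_II_AEE_beta (k : 'I_N) : beta (rev_ord k) = B k.
Proof. by have [_ ->] := htype. Qed.

Lemma type_II_AEE_B (k : 'I_N) : B (rev_ord k) = beta k.
Proof. by have [_ ->] := htype; rewrite rev_ordK. Qed.

(** The third coordinate is taken upward on the first half of the indices and downward on the
    second. As [Num.sqrt] is 0 on negative numbers, the edges sum to zero at every [t], but the
    lengths are right only where [edge_z2] is nonnegative. *)
Definition flex_edge (t : R) (k : 'I_N) : 'rV[R]_3 :=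
  vec3 (edge_x (L k) (beta k) (B k) t) (edge_y (L k) (beta k) (B k) t)
    ((-1) ^+ (M <= k)%N * Num.sqrt (edge_z2 (L k) (beta k) (B k) t)).

Lemma sum_flex_edge (t : R) :
  continuity_constraint L beta B -> \sum_k flex_edge t k = 0.
Proof.
move=> [hb hB]; rewrite sum_vec3 -vec30; congr vec3.
- apply: sum_odd_rev_ord => k.
  by rewrite type_II_AEE_L type_II_AEE_beta type_II_AEE_B edge_xC.
- rewrite -mulr_suml sumrN; under eq_bigr do rewrite mulrDr.
  by rewrite big_split /= hb hB addr0 oppr0 mul0r.
(* The square root is invariant under the reflection, while the sign flips because the two halves
   are exchanged. *)
- apply: sum_odd_rev_ord => k.
  rewrite type_II_AEE_L type_II_AEE_beta type_II_AEE_B edge_z2C leq_rev_ord.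
  by rewrite [(M <= k)%N]leqNgt -mulNr; case: (k < M)%N;
    rewrite /= ?expr0 ?expr1 ?opprK.
Qed.

Lemma cvg_flex_edge (t : R) (k : 'I_N) : 0 < t < pi / 2 ->
  (flex_edge s k @[s --> t] --> flex_edge t k)%classic.
Proof.
move=> /sin_cos_gt0_pihalf[st ct].
have {}st : sin t != 0 by rewrite gt_eqF.
have {}ct : cos t != 0 by rewrite gt_eqF.
apply: cvg_vec3; [exact: cvg_edge_x|exact: cvg_edge_y|].
apply: cvgM; first exact: cvg_cst.
apply: continuous_cvg; [exact: sqrt_continuous|exact: cvg_edge_z2].
Qed.

End TypeIIAEE.

Theorem mainTheorem2 (R : realType) (M N : nat) (hM : (2 <= M)%N)
  (hN : N = (2 * M)%N) (L beta B : 'I_N -> R)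
  (hparam : juncture_parameters L beta B)
  (htype : type_II_AEE M L beta B)
  (hcont : continuity_constraint L beta B)
  (hjunct : exists (theta : R) (v : 'I_N -> 'rV[R]_3),
     [/\ 0 < theta < pi / 2, prismatic_juncture L beta B theta v
       & nondegenerate_juncture theta v]) :
  flexible L beta B.
Proof.
have [_ _ hpar] := hparam; have [t0 [v0 [ht0 hv0 hnd]]] := hjunct.
have Lgt0 k : 0 < L k by have [] := hpar k.
have [st ct] := sin_cos_gt0_pihalf _ ht0.
have z2gt0 k : 0 < edge_z2 (L k) (beta k) (B k) t0.
  have [hn hu hw] := hv0 k.
  have [hx hy hz] := edge_coords _ _ _ _ _ ht0 hn hu hw.
  rewrite -hz lt_neqAle sqr_ge0 andbT eq_sym sqrf_eq0.
  apply: contra (hnd k) => /eqP z0.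
  by rewrite [edge _ _]vec3_eta z0 vec3_sub_uvec_wvec.
have near0 : (\forall t \near t0, 0 < t < pi / 2 /\
    forall k, 0 < edge_z2 (L k) (beta k) (B k) t)%classic.
  near=> t; split.
    suff: t \in `]0, pi / 2[ by rewrite in_itv.
    by near: t; apply: near_in_itvoo; rewrite in_itv.
  (* There are finitely many edges, so one neighborhood serves all of them. *)
  near: t; apply: filter_forall => k.
  apply: (cvgr_gt _ _ 0 (z2gt0 k)); apply: cvg_edge_z2; by rewrite gt_eqF.
have [r /= r0 hr] := (nbhs_ballP _ _).1 near0.
have hI t : t \in `]t0 - r, t0 + r[ ->
    0 < t < pi / 2 /\ forall k, 0 < edge_z2 (L k) (beta k) (B k) t.
  by move=> tI; apply: hr; rewrite ball_itv.
exists `]t0 - r, t0 + r[%classic.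
exists (fun k t => polygon_of_edges (flex_edge M L beta B t) k); split.
- exact: interval_is_interval.
- by move=> t /hI[].
- by exists t0, (t0 + r / 2); split; rewrite /= ?in_itv /=; lra.
- move=> k; apply: continuous_in_subspaceT => t /[!inE] /hI[ht _].
  by apply: cvg_big => [|j _]; [exact: add_continuous|exact: cvg_flex_edge].
- move=> t /hI[ht hz] k.
  rewrite /edge polygon_of_edgesS; last exact: (sum_flex_edge M).
  rewrite /flex_edge; set z := (-1) ^+ _ * _.
  have [hu hw] := dotv_edge (L k) (beta k) (B k) _ z ht.
  split=> //; apply: enorm_edge; first exact: ltW.
  (* The choice of sign disappears on squaring, and positivity of [edge_z2] on the interval makes
     the square root genuine. *)
  by rewrite exprMn sqrr_sign mul1r sqr_sqrtr // ltW.
Unshelve. all: by end_near.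
Qed.
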